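(* There is an absolute constant $C>0$ such that for every prime $p\geq 3$ and all subsets $A,B\subseteq\mathbb{Z}/p\mathbb{Z}$, writing $|A|=\alpha p$ and $|B|=\beta p$, there is some $x\in\mathbb{Z}/p\mathbb{Z}$ such that \[ \big||A\cap(B+x)|-\alpha\beta p\big| \;\leq\; C\,p\left(\frac{\log\log p}{\log p}\right)^{1/3}. \]
   Context: $B+x:=\{b+x: b\in B\}$. *)

(* Defs.v *)
From HB Require Import structures.
From mathcomp Require Import all_boot all_order all_algebra.
From mathcomp Require Import reals exp.

Set Implicit Arguments.
Unset Strict Implicit.
Unset Printing Implicit Defensive.

Import Order.TTheory GRing.Theory Num.Theory.
Local Open Scope ring_scope.

Definition translate (G : finZmodType) (B : {set G}) (x : G) : {set G} :=
  [set b + x | b in B].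

(* Main.v *)
(** The normalised correlation [(p |A ∩ (B+x)| - |A||B|) / p^2] is a real
    trigonometric polynomial [f] on [F_p] with mean zero whose coefficients have
    l1 norm at most 1, and the claim is that such an [f] takes a value of size
    [O(1/N)] as soon as [p >= exp (C N^3 log N)].

    For frequencies [s], let [gap s m] be the set of combinations of [s] with
    coefficients in [[-m, m]], and let [nu] be the product over [s] of the Fejér
    kernels of length [M = K m], [K = 16 N^6].  The Fourier transform of [nu] is
    nonnegative and supported on [gap s M], and positive definiteness shows that
    the characters of [gap s m] vary by [O(1/N)] in [nu]-mean.  Extending [s]
    greedily while a new frequency captures weight [1/N^2], and multiplying the
    scale by [K] while the weight of [gap s (K m)] outside the current core
    exceeds [1/N], one reaches after at most [N + 1] rounds a core [S] such that
    the coefficients in [gap s M] outside [S] are negligible, and those outside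
    [gap s M] contribute [O(1/N)] in local [nu]-mean.  So [f] is locally close
    in [nu]-mean to the constant [trig S x], and since [nu] has at most half of
    its mass at 0, some [tau <> 0] moves [trig S] by at most [2/N] uniformly.
    As [trig S] has mean zero and the multiples of [tau] exhaust [F_p], its real
    part is at most [1/N] in absolute value somewhere, hence [f] is at most
    [4/N] in absolute value at a nearby point. *)

Require Import Defs.
From HB Require Import structures.
From mathcomp Require Import all_boot all_order all_algebra all_field.
From mathcomp Require Import reals exp.
From mathcomp Require Import ring lra.

Set Implicit Arguments.
Unset Strict Implicit.
Unset Printing Implicit Defensive.

Import Order.TTheory GRing.Theory Num.Theory.
Local Open Scope ring_scope.

(** * Fejér kernels and positive definiteness *)

Section PositiveDefinite.

Variables (F : finFieldType) (e : F -> algC).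
Hypothesis eD : forall x y, e (x + y) = e x * e y.
Hypothesis e_norm : forall x, `|e x| = 1.

Lemma char_neq0 x : e x != 0.
Proof. by rewrite -normr_eq0 e_norm oner_eq0. Qed.

Lemma char0 : e 0 = 1.
Proof.
by apply: (mulfI (char_neq0 0)); rewrite -eD addr0 mulr1.
Qed.

Lemma charN x : e (- x) = (e x)^*.
Proof.
apply: (mulfI (char_neq0 x)); rewrite -eD subrr char0 -normCK e_norm.
by rewrite expr1n.
Qed.

Lemma charMn x n : e (x *+ n) = e x ^+ n.
Proof.
by elim: n => [|n IH]; rewrite ?mulr0n ?char0 // mulrS eD IH exprS.
Qed.

Definition dirichlet M t := \sum_(k < M) e (t *+ k).

Definition fejer M t := `|dirichlet M t| ^+ 2.

Lemma fejer_ge0 M t : 0 <= fejer M t.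
Proof. by rewrite exprn_ge0. Qed.

Lemma fejerE M t :
  fejer M t = \sum_(i < M) \sum_(j < M) e (t *+ i - t *+ j).
Proof.
rewrite /fejer normCK rmorph_sum mulr_suml; apply: eq_bigr => i _.
by rewrite mulr_sumr; apply: eq_bigr => j _; rewrite eD charN.
Qed.

Lemma dirichletE M t : dirichlet M t = \sum_(k < M) e t ^+ k.
Proof. by apply: eq_bigr => k _; rewrite charMn. Qed.

Lemma dirichlet_shift k M t :
  (e (t *+ k) - 1) * dirichlet M t = (e (t *+ M) - 1) * dirichlet k t.
Proof.
rewrite !dirichletE !charMn !subrX1; ring.
Qed.

(** The geometric sum identity lets the lengths [k] and [M] trade places, leaving the factor
    [|e (t *+ M) - 1| ^+ 2], which is at most 4. *)
Lemma fejer_shift k M t :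
  `|e (t *+ k) - 1| ^+ 2 * fejer M t <= 4%:R * fejer k t.
Proof.
rewrite /fejer -exprMn -normrM dirichlet_shift normrM exprMn.
apply: ler_wpM2r; first exact: fejer_ge0.
have h : `|e (t *+ M) - 1| <= 2%:R.
  by apply: le_trans (ler_normB _ _) _; rewrite e_norm normr1.
by rewrite (_ : 4%:R = 2%:R ^+ 2 :> algC) ?ler_pXn2r ?nnegrE // -natrX.
Qed.

(** Writing each index below [K * m] as a multiple of [m] plus a remainder factors the Dirichlet
    kernel. *)
Lemma fejer_mul K m t : fejer (K * m) t = fejer m t * fejer K (t *+ m).
Proof.
rewrite /fejer -exprMn -normrM; congr (`|_| ^+ _).
rewrite !dirichletE charMn; set z := e t.
elim: K => [|K IH]; first by rewrite mul0n !big_ord0 mulr0.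
rewrite mulSn addnC big_split_ord /= IH big_ord_recr /= mulrDr; congr (_ + _).
by rewrite mulr_suml; apply: eq_bigr => i _; rewrite exprD -exprM mulnC mulrC.
Qed.

Definition fourier h rho : algC := \sum_t h t * e (rho * t).

Definition pos_def h := forall rho, 0 <= fourier h rho.

Lemma fourier_fejer h M r rho :
  fourier (fun t => h t * fejer M (r * t)) rho =
  \sum_(i < M) \sum_(j < M) fourier h (rho + (r *+ i - r *+ j)).
Proof.
rewrite /fourier; under eq_bigr do rewrite fejerE.
rewrite (eq_bigr (fun t => \sum_(i < M) \sum_(j < M)
   h t * e ((rho + (r *+ i - r *+ j)) * t))); last first.
  move=> t _; rewrite mulr_sumr mulr_suml; apply: eq_bigr => i _.
  rewrite mulr_sumr mulr_suml; apply: eq_bigr => j _.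
  rewrite -mulrA -eD; congr (_ * e _).
  by rewrite mulrDl addrC mulrBl !mulrnAl.
by rewrite exchange_big; apply: eq_bigr => i _; rewrite exchange_big.
Qed.

(** The transform of the product is a sum of translates of the transform of [h]. *)
Lemma pos_def_fejer h M r :
  pos_def h -> pos_def (fun t => h t * fejer M (r * t)).
Proof.
move=> ph rho; rewrite fourier_fejer.
by apply: sumr_ge0 => i _; apply: sumr_ge0.
Qed.

Lemma fourier0 h : fourier h 0 = \sum_t h t.
Proof. by apply: eq_bigr => t _; rewrite mul0r char0 mulr1. Qed.

Lemma sum_fejer h M r :
  \sum_t h t * fejer M (r * t) =
  \sum_(i < M) \sum_(j < M) fourier h (r *+ i - r *+ j).
Proof.
rewrite -(fourier0 (fun t => h t * fejer M (r * t))) fourier_fejer.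
by apply: eq_bigr => i _; apply: eq_bigr => j _; rewrite add0r.
Qed.

(** Both sides are sums of nonnegative Fourier coefficients over index squares, and the square of
    side [k] lies inside that of side [m]. *)
Lemma sum_fejer_le h k m r : pos_def h -> (k <= m)%N ->
  \sum_t h t * fejer k (r * t) <= \sum_t h t * fejer m (r * t).
Proof.
move=> ph /subnKC <-; rewrite !sum_fejer big_split_ord /= -[X in X <= _]addr0.
apply: lerD; last by apply: sumr_ge0 => i _; apply: sumr_ge0.
apply: ler_sum => i _; rewrite big_split_ord /= lerDl.
by apply: sumr_ge0.
Qed.

(** Only the diagonal terms [i = j] are kept; each equals the total mass of [h]. *)
Lemma sum_fejer_diag h K r : pos_def h ->
  K%:R * \sum_t h t <= \sum_t h t * fejer K (r * t).
Proof.
move=> ph; rewrite sum_fejer mulr_natl.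
have -> : (\sum_t h t) *+ K = \sum_(i < K) fourier h 0.
  by rewrite sumr_const card_ord fourier0.
apply: ler_sum => i _; rewrite (bigD1 i) //= subrr lerDl.
by apply: sumr_ge0.
Qed.

Lemma sum_fejer_scale h K m r : pos_def h ->
  K%:R * \sum_t h t * fejer m (r * t) <= \sum_t h t * fejer (K * m) (r * t).
Proof.
move=> ph; apply: le_trans (sum_fejer_diag K (r *+ m) (pos_def_fejer m r ph)) _.
by apply: ler_sum => t _; rewrite mulrnAl fejer_mul -mulrA.
Qed.

(** [fejer_shift] replaces the long kernel by the one of length [k]; monotonicity enlarges [k] to
    [m], and passing from [m] to [K * m] gains the factor [K]. *)
Lemma fejer_variation h K m k r : pos_def h -> (forall t, 0 <= h t) ->
  (k <= m)%N ->
  K%:R * \sum_t h t * fejer (K * m) (r * t) * `|e (r * t *+ k) - 1| ^+ 2 <=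
  4%:R * \sum_t h t * fejer (K * m) (r * t).
Proof.
move=> ph h0 km.
apply: (@le_trans _ _ (K%:R * (4%:R * \sum_t h t * fejer k (r * t)))).
  apply: ler_wpM2l => //; rewrite mulr_sumr; apply: ler_sum => t _.
  rewrite -mulrA [X in _ <= X]mulrCA; apply: ler_wpM2l => //.
  by rewrite mulrC fejer_shift.
rewrite mulrCA; apply: ler_wpM2l => //.
apply: le_trans (sum_fejer_scale K m r ph).
by apply: ler_wpM2l => //; apply: sum_fejer_le.
Qed.

(** * Products of Fejér kernels and generalised arithmetic progressions *)

Definition fejer_prod M (s : seq F) t := \prod_(r <- s) fejer M (r * t).

Lemma fejer_prod_ge0 M s t : 0 <= fejer_prod M s t.
Proof. by apply: prodr_ge0 => r _; apply: fejer_ge0. Qed.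

Lemma fejer_prod_cons M r s t :
  fejer_prod M (r :: s) t = fejer M (r * t) * fejer_prod M s t.
Proof. exact: big_cons. Qed.

Lemma eq_fourier h h' : h =1 h' -> fourier h =1 fourier h'.
Proof. by move=> E rho; apply: eq_bigr => t _; rewrite E. Qed.

Lemma pos_def_prod h M s :
  pos_def h -> pos_def (fun t => h t * fejer_prod M s t).
Proof.
elim: s h => [|r s IH] h ph rho.
  by rewrite (eq_fourier (h' := h)) // => t; rewrite /fejer_prod big_nil mulr1.
have /(_ rho) := IH _ (pos_def_fejer M r ph).
by rewrite (eq_fourier (h' := fun t => h t * fejer_prod M (r :: s) t)) // => t;
  rewrite fejer_prod_cons -mulrA.
Qed.

Lemma fejer_prod_nil M t : fejer_prod M [::] t = 1.
Proof. exact: big_nil. Qed.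

(** Integer coefficients in [[-m, m]] are encoded as differences of two naturals at most [m], the
    form in which frequencies arise when a Fejér kernel is expanded. *)
Fixpoint gap (s : seq F) (m : nat) : {set F} :=
  if s is r :: s' then
    [set x | [exists a : 'I_m.+1, exists b : 'I_m.+1,
                x - (r *+ a - r *+ b) \in gap s' m]]
  else [set 0].

Lemma gap_consP r s m x :
  reflect (exists a b, [/\ (a <= m)%N, (b <= m)%N &
             x - (r *+ a - r *+ b) \in gap s m])
          (x \in gap (r :: s) m).
Proof.
rewrite inE; apply: (iffP existsP).
  by move=> [a /existsP[b h]]; exists a, b; split; rewrite // -ltnS ltn_ord.
move=> [a [b [am bm h]]]; exists (Ordinal (am : (a < m.+1)%N)).
by apply/existsP; exists (Ordinal (bm : (b < m.+1)%N)).
Qed.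

Lemma gap_consW r s m : gap s m \subset gap (r :: s) m.
Proof.
apply/subsetP => x xs; apply/gap_consP; exists 0%N, 0%N.
by rewrite !mulr0n !subr0.
Qed.

Lemma gap_mono s m n : (m <= n)%N -> gap s m \subset gap s n.
Proof.
move=> mn; elim: s => [|r s IH]; first exact: subxx.
apply/subsetP => x /gap_consP[a [b [am bm h]]]; apply/gap_consP; exists a, b.
by rewrite (leq_trans am) // (leq_trans bm) // (subsetP IH).
Qed.

Lemma gap_consD r s m q : (0 < m)%N -> q \in gap s m -> r + q \in gap (r :: s) m.
Proof.
move=> m0 qs; apply/gap_consP; exists 1%N, 0%N; split => //.
by rewrite mulr1n mulr0n subr0 addrC addKr.
Qed.

Lemma gapN s m x : x \in gap s m -> - x \in gap s m.
Proof.
elim: s x => [|r s IH] x; first by rewrite !inE oppr_eq0.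
move=> /gap_consP[a [b [am bm h]]]; apply/gap_consP; exists b, a; split => //.
have -> : - x - (r *+ b - r *+ a) = - (x - (r *+ a - r *+ b)) by ring.
exact: IH.
Qed.

Lemma pos_def_fejer_prod M s :
  pos_def (fun=> 1) -> pos_def (fejer_prod M s).
Proof.
move=> p1 rho; have := pos_def_prod M s p1 rho.
by rewrite (eq_fourier (h' := fejer_prod M s)) // => t; rewrite mul1r.
Qed.

Lemma fejer_prod_total_le M s rho :
  `|fourier (fejer_prod M s) rho| <= \sum_t fejer_prod M s t.
Proof.
apply: le_trans (ler_norm_sum _ _ _) _; apply: ler_sum => t _.
by rewrite normrM e_norm mulr1 ger0_norm ?fejer_prod_ge0.
Qed.

(** Pointwise [2 c y <= 1 + (c y)^2]; this turns a second moment bound into a first moment bound. *)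
Lemma young_sum (h y : F -> algC) (c b : algC) :
  0 <= c -> (forall t, 0 <= h t) -> (forall t, 0 <= y t) ->
  c ^+ 2 * \sum_t h t * y t ^+ 2 <= b ->
  2%:R * c * \sum_t h t * y t <= \sum_t h t + b.
Proof.
move=> c0 h0 y0 H.
apply: le_trans (lerD (lexx _) H).
rewrite !mulr_sumr -big_split /=; apply: ler_sum => t _.
have -> : h t + c ^+ 2 * (h t * y t ^+ 2) = h t * (1 + (c * y t) ^+ 2) by ring.
have -> : 2%:R * c * (h t * y t) = h t * (2%:R * (c * y t)) by ring.
apply: ler_wpM2l => //.
have cyR : c * y t \is Num.real by rewrite ger0_real ?mulr_ge0.
have := (real_leif_mean_square_scaled (real1 _) cyR).1.
by rewrite mul1r expr1n mulr_natl.
Qed.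

(** Induction on [s], peeling off one frequency [r] at a time. The weight [h] is arbitrary so that
    the kernel of [r] can be absorbed into it for the inductive call. Each frequency costs two
    terms, one for each of [a] and [b]. *)
Lemma fejer_prod_variation h c m s rho : pos_def h -> (forall t, 0 <= h t) ->
  rho \in gap s m ->
  c%:R * \sum_t h t * fejer_prod (4 * c ^ 2 * m) s t * `|e (rho * t) - 1| <=
  2%:R * (size s)%:R * \sum_t h t * fejer_prod (4 * c ^ 2 * m) s t.
Proof.
set K := (4 * c ^ 2)%N.
elim: s h rho => [|r s IH] h rho ph h0.
  rewrite inE => /eqP ->; rewrite big1 ?mulr0 ?mul0r // => t _.
  by rewrite mul0r char0 subrr normr0 mulr0.
move=> /gap_consP[a [b [am bm]]]; set q := rho - _ => qs.
pose g t := h t * fejer_prod (K * m) s t.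
have pg : pos_def g by apply: pos_def_prod.
have g0 t : 0 <= g t by rewrite mulr_ge0 ?fejer_prod_ge0.
have gE t : h t * fejer_prod (K * m) (r :: s) t = g t * fejer (K * m) (r * t).
  by rewrite fejer_prod_cons mulrCA mulrC.
pose h' t := h t * fejer (K * m) (r * t).
have h'E t : h t * fejer_prod (K * m) (r :: s) t = h' t * fejer_prod (K * m) s t.
  by rewrite fejer_prod_cons mulrA.
set T := \sum_t h t * _ in IH *.
have T0 : 0 <= T by apply: sumr_ge0 => t _; rewrite mulr_ge0 ?fejer_prod_ge0.
(* The kernels of the remaining frequencies join the weight as [g]. The scale factor [4 * c ^ 2]
   cancels the 4 of [fejer_variation] and leaves the [c ^ 2] that [young_sum] requires. *)
have one k : (k <= m)%N ->
    c%:R * \sum_t g t * fejer (K * m) (r * t) * `|e (r * t *+ k) - 1| <= T.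
  move=> km.
  have TE : T = \sum_t g t * fejer (K * m) (r * t).
    by apply: eq_bigr => t _; rewrite gE.
  have V := fejer_variation K r pg g0 km.
  rewrite -TE in V.
  have /(_ c%:R T) Y := young_sum (h := fun t => g t * fejer (K * m) (r * t))
    (y := fun t => `|e (r * t *+ k) - 1|).
  rewrite -(ler_pM2l (ltr0n _ 2)) mulrA.
  have -> : 2%:R * T = \sum_t g t * fejer (K * m) (r * t) + T.
    by rewrite -TE mulr_natl mulr2n.
  apply: Y => // [t|]; first by rewrite mulr_ge0 ?fejer_ge0.
  rewrite -(ler_pM2l (ltr0n _ 4)); apply: le_trans V.
  by rewrite /K natrM natrX mulrA.
have tri t : `|e (rho * t) - 1| <=
    `|e (r * t *+ a) - 1| + `|e (r * t *+ b) - 1| + `|e (q * t) - 1|.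
  set u := e (r * t *+ a); set v := e (r * t *+ b); set z := e (q * t).
  have -> : e (rho * t) = u * v^* * z.
    by rewrite -charN -!eD; congr e; rewrite /q -!mulrnAl; ring.
  have nu1 : `|u| = 1 by apply: e_norm.
  have nv1 : `|v| = 1 by apply: e_norm.
  have -> : u * v^* * z - 1 = (u - 1) * (v^* * z) + ((v - 1)^* * z + (z - 1)).
    by rewrite rmorphB rmorph1; ring.
  apply: le_trans (ler_normD _ _) _; rewrite -addrA; apply: lerD.
    by rewrite !normrM norm_conjC nv1 (e_norm (q * t)) !mulr1.
  apply: le_trans (ler_normD _ _) _; rewrite lerD2r.
  by rewrite normrM norm_conjC (e_norm (q * t)) mulr1.
have IHq : c%:R * \sum_t h t * fejer_prod (K * m) (r :: s) t * `|e (q * t) - 1|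
   <= 2%:R * (size s)%:R * T.
  have h'0 t : 0 <= h' t by rewrite mulr_ge0 ?fejer_ge0.
  have := IH h' q (pos_def_fejer _ _ ph) h'0 qs.
  rewrite -(eq_bigr _ (fun t _ => h'E t)).
  by under [X in c%:R * X <= _ -> _]eq_bigr do rewrite -h'E.
have -> : 2%:R * (size (r :: s))%:R * T = T + T + 2%:R * (size s)%:R * T.
  by rewrite /= -natr1; ring.
apply: le_trans (lerD (lerD (one a am) (one b bm)) IHq).
rewrite -!mulrDr -!big_split /=.
apply: ler_wpM2l => //; apply: ler_sum => t _.
rewrite -!gE -!mulrDr; apply: ler_wpM2l; last exact: tri.
by rewrite mulr_ge0 ?fejer_prod_ge0.
Qed.

End PositiveDefinite.

(** * Splitting the spectrum *)

Section SpectralDecomposition.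

Variables (F : finFieldType) (e : F -> algC).
Hypothesis eD : forall x y, e (x + y) = e x * e y.
Hypothesis e_norm : forall x, `|e x| = 1.
Hypothesis e_sum :
  forall rho : F, \sum_t e (rho * t) = if rho == 0 then #|F|%:R else 0.

Local Notation nu := (fejer_prod e).
Local Notation total M s := (\sum_t fejer_prod e M s t).

Lemma pos_def1 : pos_def e (fun=> 1).
Proof.
move=> rho; rewrite /fourier; under eq_bigr do rewrite mul1r.
by rewrite e_sum; case: ifP.
Qed.

Lemma fourier_fejer_prod_cons M r s rho :
  fourier e (nu M (r :: s)) rho =
  \sum_(i < M) \sum_(j < M) fourier e (nu M s) (rho + (r *+ i - r *+ j)).
Proof.
rewrite -fourier_fejer //; apply: eq_fourier => t.
by rewrite fejer_prod_cons mulrC.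
Qed.

(** Each kernel spreads the support of the transform only by differences [r *+ i - r *+ j] with
    [i, j < M]. *)
Lemma fourier_fejer_prod_eq0 M s rho :
  rho \notin gap s M -> fourier e (nu M s) rho = 0.
Proof.
elim: s rho => [|r s IH] rho.
  rewrite inE => h; rewrite (eq_fourier e (fejer_prod_nil e M)) /fourier.
  by under eq_bigr do rewrite mul1r; rewrite e_sum (negbTE h).
move=> h; rewrite fourier_fejer_prod_cons big1 // => i _; rewrite big1 // => j _.
apply: IH; apply: contra h => h; apply/gap_consP; exists j, i.
by rewrite opprB !(ltnW (ltn_ord _)).
Qed.

Lemma fejer_prod_total_ge M s : (M ^ size s * #|F|)%:R <= total M s.
Proof.
elim: s => [|r s IH].
  by under eq_bigr do rewrite fejer_prod_nil; rewrite sumr_const mul1n.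
have := sum_fejer_diag eD e_norm M r (pos_def_fejer_prod eD e_norm M s pos_def1).
under [X in _ <= X -> _]eq_bigr do rewrite mulrC -fejer_prod_cons.
apply: le_trans; rewrite expnS -mulnA natrM.
by apply: ler_wpM2l.
Qed.

Lemma fejer_prod_at0 M s : nu M s 0 = (M ^ size s)%:R ^+ 2.
Proof.
elim: s => [|r s IH]; first by rewrite fejer_prod_nil expr1n.
rewrite fejer_prod_cons IH expnS natrM exprMn; congr (_ * _).
rewrite /fejer /dirichlet mulr0; congr (_ ^+ 2).
under eq_bigr do rewrite mul0rn (char0 eD e_norm).
by rewrite sumr_const card_ord normr_nat.
Qed.

(** The value at 0 is the square of [M ^ size s], while the mass is at least [M ^ size s] times the
    order of the field. *)
Lemma fejer_prod_at0_le M s :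
  (2 * M ^ size s <= #|F|)%N -> 2%:R * nu M s 0 <= total M s.
Proof.
move=> h; apply: le_trans (fejer_prod_total_ge M s).
rewrite fejer_prod_at0 -natrX -natrM ler_nat mulnCA leq_mul2l.
by rewrite h orbT.
Qed.

(** * Weights, trigonometric polynomials and their local energy *)

Variable a : F -> algC.

Definition weight (S : {set F}) := \sum_(rho in S) `|a rho|.

Definition trig (S : {set F}) x := \sum_(rho in S) a rho * e (rho * x).

Lemma weight_ge0 S : 0 <= weight S.
Proof. by apply: sumr_ge0. Qed.

Lemma weight_real S : weight S \is Num.real.
Proof. by rewrite ger0_real ?weight_ge0. Qed.

Lemma weight_diff (S S' : {set F}) :
  S' \subset S -> weight S = weight S' + weight (S :\: S').
Proof.
move=> sub; rewrite /weight (big_setID S') /=; congr (_ + _).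
by apply: eq_bigl => x; rewrite (setIidPr sub).
Qed.

Lemma weight_subset (S S' : {set F}) : S' \subset S -> weight S' <= weight S.
Proof. by move=> sub; rewrite (weight_diff sub) lerDl weight_ge0. Qed.

Lemma trig_diff (S S' : {set F}) x :
  S' \subset S -> trig S x = trig S' x + trig (S :\: S') x.
Proof.
move=> sub; rewrite /trig (big_setID S') /=; congr (_ + _).
by apply: eq_bigl => y; rewrite (setIidPr sub).
Qed.

Lemma trig_le S x : `|trig S x| <= weight S.
Proof.
apply: le_trans (ler_norm_sum _ _ _) _; apply: ler_sum => rho _.
by rewrite normrM e_norm mulr1.
Qed.

Definition oscillation (S : {set F}) t :=
  \sum_(rho in S) `|a rho| * `|e (rho * t) - 1|.

Lemma oscillation_ge0 S t : 0 <= oscillation S t.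
Proof. by apply: sumr_ge0 => rho _; rewrite mulr_ge0. Qed.

Lemma trig_shift S x t : `|trig S (x + t) - trig S x| <= oscillation S t.
Proof.
rewrite /trig -sumrB; apply: le_trans (ler_norm_sum _ _ _) _.
apply: ler_sum => rho _; rewrite mulrDr eD -mulrBr normrM.
by rewrite -[X in _ - X]mulr1 -mulrBr normrM e_norm mul1r.
Qed.

Lemma sum_energy (U : {set F}) M s x :
  \sum_t nu M s t * `|trig U (x + t)| ^+ 2 =
  \sum_(rho in U) \sum_(sg in U)
    a rho * (a sg)^* * e ((rho - sg) * x) * fourier e (nu M s) (rho - sg).
Proof.
transitivity (\sum_t \sum_(rho in U) \sum_(sg in U)
   a rho * (a sg)^* * e ((rho - sg) * x) * (nu M s t * e ((rho - sg) * t))).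
  apply: eq_bigr => t _; rewrite normCK rmorph_sum mulr_suml mulr_sumr.
  apply: eq_bigr => rho _; rewrite mulr_sumr mulr_sumr; apply: eq_bigr => sg _.
  rewrite rmorphM /= -(charN eD e_norm) mulrBl [(rho - sg) * t]mulrBl.
  by rewrite -!mulNr !mulrDr !eD; ring.
rewrite exchange_big; apply: eq_bigr => rho _; rewrite exchange_big.
by apply: eq_bigr => sg _; rewrite mulr_sumr.
Qed.

(** In the expanded square, the pair [rho], [sg] contributes only if [rho - sg] is in [gap s M], and
    then its Fourier coefficient is at most the total mass. *)
Lemma energy_le (U : {set F}) M s (eta : algC) x :
  (forall rho, rho \in U ->
     weight (U :&: [set sg | rho - sg \in gap s M]) <= eta) ->
  \sum_t nu M s t * `|trig U (x + t)| ^+ 2 <= weight U * eta * total M s.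
Proof.
move=> H.
have -> : \sum_t nu M s t * `|trig U (x + t)| ^+ 2 =
    `|\sum_t nu M s t * `|trig U (x + t)| ^+ 2|.
  rewrite ger0_norm //; apply: sumr_ge0 => t _.
  by rewrite mulr_ge0 ?fejer_prod_ge0 ?exprn_ge0.
rewrite sum_energy; apply: le_trans (ler_norm_sum _ _ _) _.
rewrite /weight !mulr_suml; apply: ler_sum => rho rhoU.
apply: le_trans (ler_norm_sum _ _ _) _.
apply: (@le_trans _ _ (`|a rho| *
   weight (U :&: [set sg | rho - sg \in gap s M]) * total M s)); last first.
  apply: ler_wpM2r; first by apply: sumr_ge0 => t _; apply: fejer_prod_ge0.
  by apply: ler_wpM2l => //; apply: H.
have := fejer_prod_total_le e_norm M s; move: (total M s) => T leT.
rewrite /weight mulr_sumr mulr_suml.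
rewrite [X in _ <= X](eq_bigl (fun sg => (sg \in U) && (rho - sg \in gap s M)));
  last by move=> sg; rewrite !inE.
rewrite [X in _ <= X]big_mkcondr /=; apply: ler_sum => sg _.
rewrite !normrM norm_conjC e_norm mulr1; case: ifPn => [_|h].
  by apply: ler_wpM2l; rewrite ?mulr_ge0.
by rewrite fourier_fejer_prod_eq0 // normr0 mulr0.
Qed.

(** * Approximation by a core of frequencies, and the search for it *)

Hypothesis weightT : weight setT <= 1.

Lemma weight_le1 S : weight S <= 1.
Proof. by apply: le_trans weightT; apply/weight_subset/subsetT. Qed.

Variable N : nat.
Hypothesis N_gt0 : (0 < N)%N.

(** The scale factor of [fejer_prod_variation] for [c = 2 * N ^ 3]: with at most [N ^ 2]
    frequencies, the mean variation is then at most [2 N^2 / (2 N^3) = 1 / N]. *)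
Let K := (4 * (2 * N ^ 3) ^ 2)%N.

Lemma fejer_prod_total_ge0 M s : 0 <= total M s.
Proof. by apply: sumr_ge0 => t _; apply: fejer_prod_ge0. Qed.

Lemma oscillation_mean (S : {set F}) s m :
  (size s <= N ^ 2)%N -> S \subset gap s m ->
  N%:R * \sum_t nu (K * m) s t * oscillation S t <= total (K * m) s.
Proof.
move=> sN sub.
have one rho : rho \in S ->
    N%:R * \sum_t nu (K * m) s t * `|e (rho * t) - 1| <= total (K * m) s.
  move=> /(subsetP sub) rs.
  have := fejer_prod_variation eD e_norm (2 * N ^ 3) pos_def1 (fun=> ler01) rs.
  under [X in _ * X <= _ -> _]eq_bigr do rewrite mul1r.
  under [X in _ <= _ * X -> _]eq_bigr do rewrite mul1r.
  rewrite -/K; set X := \sum_t _ ; set T := total _ _ => h.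
  have N2 : (0 : algC) < (2 * N ^ 2)%:R by rewrite ltr0n muln_gt0 expn_gt0 N_gt0.
  rewrite -(ler_pM2l N2) mulrA -natrM -mulnA -expnSr; apply: le_trans h _.
  apply: ler_wpM2r; first exact: fejer_prod_total_ge0.
  by rewrite -natrM ler_nat leq_mul2l.
have -> : \sum_t nu (K * m) s t * oscillation S t =
   \sum_(rho in S) `|a rho| * \sum_t nu (K * m) s t * `|e (rho * t) - 1|.
  rewrite /oscillation; under eq_bigr do rewrite mulr_sumr.
  rewrite exchange_big; apply: eq_bigr => rho _; rewrite mulr_sumr.
  by apply: eq_bigr => t _; rewrite mulrCA.
rewrite mulr_sumr; apply: (@le_trans _ _ (weight S * total (K * m) s)).
  rewrite /weight mulr_suml; apply: ler_sum => rho rS.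
  by rewrite mulrCA; apply: ler_wpM2l => //; apply: one.
by rewrite -[X in _ <= X]mul1r ler_wpM2r ?fejer_prod_total_ge0 // weight_le1.
Qed.

(* [S] is the core: [gap s (K * m) :\: S] carries little weight, and no translate
   of [gap s (K * m)] carries much weight outside [gap s (K * m)]. *)
Record good_pair (S : {set F}) (s : seq F) (m : nat) : Prop := GoodPair {
  good_size : (size s <= N ^ 2)%N;
  good_sub : S \subset gap s m;
  good_middle : N%:R * weight (gap s (K * m) :\: S) <= 1;
  good_outer : forall rho, rho \notin gap s (K * m) ->
    N%:R ^+ 2 *
      weight (~: gap s (K * m) :&: [set sg | rho - sg \in gap s (K * m)]) <= 1 }.

(** [energy_le] with [eta = 1 / N^2] bounds the mean square, and [young_sum] passes to the mean. *)
Lemma outer_mean s M x :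
  (forall rho, rho \notin gap s M ->
    N%:R ^+ 2 * weight (~: gap s M :&: [set sg | rho - sg \in gap s M]) <= 1) ->
  N%:R * \sum_t nu M s t * `|trig (~: gap s M) (x + t)| <= total M s.
Proof.
move=> H; have N0 : (0 : algC) < N%:R ^+ 2 by rewrite exprn_gt0 ?ltr0n.
have E : N%:R ^+ 2 * \sum_t nu M s t * `|trig (~: gap s M) (x + t)| ^+ 2
    <= total M s.
  rewrite mulrC -ler_pdivlMr //.
  apply: le_trans (energy_le (eta := N%:R ^- 2) _ _) _.
    move=> rho; rewrite inE => /H h.
    by rewrite -[X in _ <= X]mul1r ler_pdivlMr // mulrC.
  rewrite mulrC ler_wpM2l ?fejer_prod_total_ge0 // -[X in _ <= X]mul1r.
  by rewrite ler_wpM2r ?weight_le1 // invr_ge0 ltW.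
have := young_sum (ler0n _ N) (fejer_prod_ge0 e M s)
   (fun t => normr_ge0 (trig (~: gap s M) (x + t))) E.
by rewrite -mulr2n -[X in _ <= X -> _]mulr_natl -mulrA ler_pM2l ?ltr0n.
Qed.

Lemma good_pair_mean S s m x : (0 < m)%N -> good_pair S s m ->
  N%:R * \sum_t nu (K * m) s t * `|trig setT (x + t) - trig S x|
    <= 3%:R * total (K * m) s.
Proof.
move=> m0 [sN sub mid out].
have K0 : (0 < K)%N by rewrite /K !(muln_gt0, expn_gt0) N_gt0.
have sub' : S \subset gap s (K * m).
  by apply: subset_trans sub _; apply: gap_mono; rewrite leq_pmull.
have -> : 3%:R * total (K * m) s =
    total (K * m) s + (total (K * m) s + total (K * m) s) by ring.
apply: le_trans (lerD (outer_mean x out)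
  (lerD (oscillation_mean sN sub) (lexx _))).
have M1 : N%:R * \sum_t nu (K * m) s t * weight (gap s (K * m) :\: S)
    <= total (K * m) s.
  rewrite -mulr_suml mulrCA -[X in _ <= X]mulr1.
  by rewrite ler_wpM2l // fejer_prod_total_ge0.
apply: le_trans (lerD (lexx _) (lerD (lexx _) M1)).
rewrite -!mulrDr -!big_split /=; apply: ler_wpM2l => //.
apply: ler_sum => t _; rewrite -!mulrDr ler_wpM2l ?fejer_prod_ge0 //.
(* Three errors, each of mean at most [1 / N]: the outer frequencies, the shift of the core, and the
   middle layer. *)
have -> : trig setT (x + t) - trig S x = trig (~: gap s (K * m)) (x + t) +
   ((trig S (x + t) - trig S x) + trig (gap s (K * m) :\: S) (x + t)).
  rewrite (trig_diff (x + t) (subsetT (gap s (K * m)))) setTD.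
  by rewrite (trig_diff (x + t) sub'); ring.
apply: le_trans (ler_normD _ _) _; rewrite lerD2l.
apply: le_trans (ler_normD _ _) _; apply: lerD; first exact: trig_shift.
exact: trig_le.
Qed.

(* Each frequency of [s] accounts for weight [1 / N^2], which bounds [size s]. *)
Definition sparse s m := (size s)%:R <= N%:R ^+ 2 * weight (gap s m).

Lemma sparse_size s m : sparse s m -> (size s <= N ^ 2)%N.
Proof.
move=> h; rewrite -(ler_nat algC); apply: le_trans h _.
by rewrite natrX -[X in _ <= X]mulr1 ler_wpM2l ?exprn_ge0 ?weight_le1.
Qed.

(** Greedy choice: while some [rho] violates the conclusion, it is added to the list. The list stays
    sparse, so its size cannot pass [N ^ 2] and the process stops. *)
Lemma sparse_extension s M : (0 < M)%N -> sparse s M ->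
  exists2 s', sparse s' M & (forall m, gap s m \subset gap s' m) /\
    forall rho, rho \notin gap s' M ->
      N%:R ^+ 2 * weight (~: gap s' M :&: [set sg | rho - sg \in gap s' M]) <= 1.
Proof.
move=> M0; have [n] := ubnP (N ^ 2 - size s); elim: n s => // n IH s ns sp.
pose heavy rho := (rho \notin gap s M) && (1 <=
  N%:R ^+ 2 * weight (~: gap s M :&: [set sg | rho - sg \in gap s M])).
have [/existsP[r /andP[rs hr]]|/existsPn nh] :=
  boolP [exists r, heavy r]; last first.
  exists s => //; split=> // rho rs; have := nh rho; rewrite /heavy rs /=.
  rewrite -real_ltNge ?real1 //; first exact: ltW.
  by rewrite realM ?weight_real // realX ?realn.
have sp' : sparse (r :: s) M.
  rewrite /sparse /= -natr1; apply: le_trans (lerD sp hr) _.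
  rewrite -mulrDr ler_wpM2l ?exprn_ge0 //.
  (* The weight captured by [r] is new: an [x] outside the old gap with [r - x] inside it equals [r]
     plus an element of that symmetric set, so it lies in the enlarged gap. *)
  rewrite (weight_diff (gap_consW r s M)) lerD2l; apply: weight_subset.
  apply/subsetP => x; rewrite in_setI in_setC => /andP[xs].
  rewrite in_set => h; rewrite in_setD xs -(subKr r x) opprB.
  by apply: gap_consD => //; rewrite -opprB gapN.
have [|s' sps' [sub out]] := IH (r :: s) _ sp'.
  by rewrite /= subnS prednK ?subn_gt0 //; apply: sparse_size sp'.
exists s' => //; split => // m; apply: subset_trans (sub m); exact: gap_consW.
Qed.

(* [n] bounds the number of remaining rounds: each failed round gains weight
   more than [1 / N]. *)
Lemma good_pair_search n s m : (0 < m)%N -> sparse s m ->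
  N.+1%:R <= n%:R + N%:R * weight (gap s m) ->
  exists S s' m', [/\ (0 < m')%N, (K * m' <= K ^ n * m)%N & good_pair S s' m'].
Proof.
have K0 : (0 < K)%N by rewrite /K !(muln_gt0, expn_gt0) N_gt0.
elim: n s m => [|n IH] s m m0 sp.
  (* With no rounds left the gap would have weight above 1. *)
  rewrite add0r -natr1 => h; exfalso.
  have : N%:R + 1 <= N%:R * 1 :> algC.
    by apply: le_trans h _; rewrite ler_wpM2l ?weight_le1.
  by rewrite mulr1 gerDl ler10.
move=> h; have Km0 : (0 < K * m)%N by rewrite muln_gt0 K0.
have mKm : (m <= K * m)%N by rewrite leq_pmull.
have sp1 : sparse s (K * m).
  apply: le_trans sp _; rewrite ler_wpM2l ?exprn_ge0 //.
  by apply: weight_subset; apply: gap_mono.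
have [s' sp' [sub out]] := sparse_extension Km0 sp1.
(* If the middle layer is light, [gap s m] is the core; otherwise the search continues from [s'] at
   scale [K * m]. *)
have [mid|mid] := boolP (N%:R * weight (gap s' (K * m) :\: gap s m) <= 1).
  exists (gap s m), s', m; split=> //.
    by rewrite expnS -mulnA leq_mul2l leq_pmull ?expn_gt0 ?K0 ?orbT.
  by split=> //; apply: sparse_size sp'.
have sub1 : gap s m \subset gap s' (K * m).
  exact: subset_trans (sub m) (gap_mono _ mKm).
have [|S [s1 [m1 [m10 m1le g]]]] := IH s' (K * m)%N Km0 sp'.
  rewrite (weight_diff sub1) mulrDr addrA addrAC; apply: le_trans h _.
  rewrite -natr1 lerD2r lerD2l ltW // real_ltNge ?real1 //.
  by rewrite realM ?weight_real.
by exists S, s1, m1; split=> //; rewrite expnSr -mulnA.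
Qed.

Lemma good_pair_exists :
  exists S s m, [/\ (0 < m)%N, (K * m <= K ^ N.+1)%N & good_pair S s m].
Proof.
have [||S [s [m [m0 le g]]]] := @good_pair_search N.+1 [::] 1 isT.
- by rewrite /sparse /= mulr_ge0 ?weight_ge0 ?exprn_ge0.
- by rewrite lerDl mulr_ge0 ?weight_ge0.
by exists S, s, m; rewrite muln1 in le.
Qed.


(** * From weighted means to a small value *)

Lemma weighted_mean_le (P : pred F) (h u : F -> algC) (b : algC) :
  (forall t, 0 <= h t) -> (forall t, u t \is Num.real) -> b \is Num.real ->
  0 < \sum_(t | P t) h t ->
  \sum_(t | P t) h t * u t <= b * \sum_(t | P t) h t ->
  exists2 t, P t & u t <= b.
Proof.
move=> h0 uR bR hpos H.
have [/existsP[t /andP[Pt tb]]|/existsPn nt] := boolP [exists t, P t && (u t <= b)].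
  by exists t.
have ub t : P t -> b < u t.
  by move=> Pt; have := nt t; rewrite Pt /= real_ltNge.
have d0 t : P t -> 0 <= h t * (u t - b).
  by move=> Pt; rewrite mulr_ge0 // subr_ge0 ltW ?ub.
have s0 : \sum_(t | P t) h t * (u t - b) = 0.
  apply/eqP; rewrite eq_le sumr_ge0 // andbT.
  under eq_bigr do rewrite mulrBr.
  by rewrite sumrB -mulr_suml subr_le0 [X in _ <= X]mulrC.
exfalso; move: hpos; rewrite big1 ?ltxx // => t Pt; apply/eqP.
have /eqP := psumr_eq0P d0 s0 Pt.
by rewrite mulf_eq0 subr_eq0 [_ == b]eq_sym (lt_eqF (ub t Pt)) orbF.
Qed.

Hypothesis F_cyclic :
  forall tau x y : F, tau != 0 -> exists k, y = x + tau *+ k.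

(** If [|v|] exceeded [c] everywhere, a step of [tau] could not change the sign, since that would be
    a jump of more than [2 c]. The sign would then be constant on the whole field, against the zero
    sum. *)
Lemma sum_sign_change (v : F -> algC) tau c : tau != 0 -> 0 < c ->
  (forall x, v x \is Num.real) -> \sum_x v x = 0 ->
  (forall x, `|v (x + tau) - v x| <= 2%:R * c) ->
  exists x, `|v x| <= c.
Proof.
move=> tau0 c0 vR v0 vtau.
have [/existsP//|/existsPn nv] := boolP [exists x, `|v x| <= c].
have cR : c \is Num.real by rewrite ger0_real ?ltW.
have cv x : c < `|v x| by rewrite real_ltNge ?nv ?normr_real.
have key (w : F -> algC) : (forall x, w x \is Num.real) -> \sum_x w x = 0 ->
    (forall x, `|w (x + tau) - w x| <= 2%:R * c) -> (forall x, c < `|w x|) ->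
    ~ 0 < w 0.
  move=> wR w0 wtau cw wpos.
  have step x : 0 < w x -> 0 < w (x + tau).
    move=> wx; rewrite real_ltNge ?real0 //; apply/negP => wx'.
    have := cw x; rewrite (gtr0_norm wx) => h1.
    have := cw (x + tau); rewrite (ler0_norm wx') => h2.
    have d0 : 0 <= w x - w (x + tau) by rewrite subr_ge0 (le_trans wx') ?ltW.
    have := wtau x; rewrite distrC (ger0_norm d0).
    by rewrite mulr_natl mulr2n lt_geF // ltrD.
  have all x : 0 < w x.
    have [k ->] := F_cyclic 0 x tau0.
    by elim: k => [|k IH]; rewrite ?mulr0n ?addr0 // mulrSr addrA step.
  have : 0 < \sum_x w x.
    by rewrite (bigD1 0) //= ltr_pwDl // sumr_ge0 // => x _; rewrite ltW.
  by rewrite w0 ltxx.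
exfalso; have v00 : 0 < `|v 0| by apply: lt_trans (cv 0).
have [v0pos|v0neg|v0eq] := real_ltgtP (real0 _) (vR 0).
- exact: (key v).
- apply: (key (fun x => - v x)).
  + by move=> x; rewrite realN.
  + by rewrite sumrN v0 oppr0.
  + by move=> x; rewrite -opprD normrN.
  + by move=> x; rewrite normrN.
  + by rewrite oppr_gt0.
- by rewrite -v0eq normr0 ltxx in v00.
Qed.

Hypothesis a0 : a 0 = 0.

Lemma sum_trig S : \sum_x trig S x = 0.
Proof.
rewrite /trig exchange_big big1 // => rho _; rewrite -mulr_sumr e_sum.
by case: eqP => [->|_]; rewrite ?a0 ?mul0r ?mulr0.
Qed.

Hypothesis F_large : (2 * (K ^ N.+1) ^ (N ^ 2) <= #|F|)%N.

Lemma real_trig_small : (forall x, trig setT x \is Num.real) ->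
  exists x, N%:R * `|trig setT x| <= 4%:R.
Proof.
move=> fR; have [S [s [m [m0 Mle g]]]] := good_pair_exists.
have K0 : (0 < K)%N by rewrite /K !(muln_gt0, expn_gt0) N_gt0.
have N0 : (0 : algC) < N%:R by rewrite ltr0n.
have NR : (N%:R : algC) \is Num.real by rewrite realn.
set M := (K * m)%N in Mle *; set T := total M s.
have M0 : (0 < M)%N by rewrite muln_gt0 K0.
have T0 : 0 < T.
  apply: lt_le_trans (fejer_prod_total_ge M s).
  by rewrite ltr0n muln_gt0 expn_gt0 M0 /=; apply/card_gt0P; exists 0.
(* [F_large] is tailored to this point: [M] is at most [K ^ N.+1] and [s] has at most [N ^ 2]
   entries. *)
have T2 : 2%:R * nu M s 0 <= T.
  apply/fejer_prod_at0_le/(leq_trans _ F_large); rewrite leq_mul2l /=.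
  apply: (@leq_trans ((K ^ N.+1) ^ size s)).
    by case: (size s) => // k; rewrite leq_exp2r.
  by rewrite leq_pexp2l ?(good_size g) // expn_gt0 K0.
have E0 : T = nu M s 0 + \sum_(t | t != 0) nu M s t by rewrite /T (bigD1 0).
have half : T <= 2%:R * \sum_(t | t != 0) nu M s t.
  rewrite -(lerD2l (2%:R * nu M s 0)) -mulrDr -E0 (mulr_natl T) mulr2n.
  by rewrite lerD2r.
(* Discarding [t = 0] costs at most half of the mass, which turns the bound [1 / N] into [2 / N]. *)
have [tau tau0 osc] : exists2 tau, tau != 0 & oscillation S tau <= 2%:R / N%:R.
  apply: (@weighted_mean_le _ (nu M s)).
  - exact: fejer_prod_ge0.
  - by move=> t; rewrite ger0_real ?oscillation_ge0.
  - by rewrite realM ?realV ?realn.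
  - by rewrite -(pmulr_rgt0 _ (ltr0n _ 2)); apply: lt_le_trans half.
  rewrite mulrAC ler_pdivlMr // mulrC; apply: le_trans half.
  apply: le_trans (oscillation_mean (good_size g) (good_sub g)).
  rewrite ler_wpM2l // -/M [X in _ <= X](bigD1 0) //= lerDr.
  by rewrite mulr_ge0 ?fejer_prod_ge0 ?oscillation_ge0.
(* The core polynomial is not known to be real, so the sign argument is applied to its real part;
   this suffices because the full polynomial is real. *)
have [x vx] : exists x, `|'Re (trig S x)| <= N%:R^-1.
  apply: (sum_sign_change tau0).
  - by rewrite invr_gt0.
  - by move=> x; apply: Creal_Re.
  - by rewrite -raddf_sum sum_trig raddf0.
  - move=> x; rewrite -raddfB; apply: le_trans (leif_normC_Re_Creal _).1 _.
    exact: le_trans (trig_shift _ _ _) osc.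
have [t _ ut] : exists2 t, predT t & `|trig setT (x + t) - trig S x| <= 3%:R / N%:R.
  apply: (@weighted_mean_le _ (nu M s)).
  - exact: fejer_prod_ge0.
  - by move=> t; apply: normr_real.
  - by rewrite realM ?realV ?realn.
  - exact: T0.
  rewrite mulrAC ler_pdivlMr // mulrC.
  exact: (good_pair_mean x m0 g).
exists (x + t); rewrite mulrC -ler_pdivlMr //.
have -> : trig setT (x + t) =
    'Re (trig setT (x + t) - trig S x) + 'Re (trig S x).
  by rewrite raddfB subrK; apply/esym/Creal_ReP.
apply: le_trans (ler_normD _ _) _.
have -> : 4%:R / N%:R = 3%:R / N%:R + N%:R^-1 :> algC by ring.
apply: lerD => //; exact: le_trans (leif_normC_Re_Creal _).1 ut.
Qed.

End SpectralDecomposition.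

(** * Correlations of sets in prime fields *)

Section Counting.

Variables (F : finFieldType) (e : F -> algC).
Hypothesis eD : forall x y, e (x + y) = e x * e y.
Hypothesis e_norm : forall x, `|e x| = 1.
Hypothesis e_sum :
  forall rho : F, \sum_t e (rho * t) = if rho == 0 then #|F|%:R else 0.

Definition set_fourier (A : {set F}) rho := \sum_(u in A) e (rho * u).

(** Orthogonality in [rho] leaves the pairs [u], [v] with [u = v + x]. *)
Lemma set_fourier_correlation (A B : {set F}) x :
  \sum_rho (set_fourier A rho)^* * set_fourier B rho * e (rho * x) =
  (#|F| * #|A :&: translate B x|)%:R.
Proof.
transitivity (\sum_rho \sum_(u in A) \sum_(v in B) e ((v + x - u) * rho)).
  apply: eq_bigr => rho _; rewrite rmorph_sum !mulr_suml.
  apply: eq_bigr => u _; rewrite mulr_sumr mulr_suml; apply: eq_bigr => v _.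
  rewrite /= -(charN eD e_norm) -!eD; congr e; ring.
rewrite exchange_big /= (eq_bigr (fun u => \sum_(v in B)
   if v + x - u == 0 then #|F|%:R else 0)); last first.
  by move=> u _; rewrite exchange_big; apply: eq_bigr => v _; rewrite e_sum.
rewrite natrM -[#|A :&: _|]sum1_card natr_sum mulr_sumr.
rewrite [RHS](eq_bigl (fun u => (u \in A) && (u \in translate B x))); last first.
  by move=> u; rewrite inE.
rewrite [RHS]big_mkcondr /=; apply: eq_bigr => u _.
case: imsetP => [[v vB ->]|nB]; last first.
  rewrite big1 // => v vB; rewrite subr_eq0; case: eqP => // E.
  by case: nB; exists v.
rewrite (bigD1 v) //= subrr eqxx big1 ?addr0 ?mulr1 // => w /andP[_ wv].
by rewrite subr_eq0 (inj_eq (addIr x)) (negbTE wv).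
Qed.

Lemma set_fourier_parseval (A : {set F}) :
  \sum_rho `|set_fourier A rho| ^+ 2 = (#|F| * #|A|)%:R.
Proof.
have := set_fourier_correlation A A 0.
have -> : translate A 0 = A.
  by rewrite /translate (eq_imset (g := id)) ?imset_id // => u; rewrite addr0.
rewrite setIid => <-; apply: eq_bigr => rho _.
by rewrite mulr0 (char0 eD e_norm) mulr1 normCK mulrC.
Qed.

Lemma set_fourier0 (A : {set F}) : set_fourier A 0 = #|A|%:R.
Proof.
rewrite /set_fourier; under eq_bigr do rewrite mul0r (char0 eD e_norm).
by rewrite sumr_const.
Qed.

Variables (A B : {set F}).

(** Dropping the zero frequency subtracts the expected value and makes the polynomial mean zero. *)
Definition correlation_coef rho :=
  if rho == 0 then 0
  else (set_fourier A rho)^* * set_fourier B rho / #|F|%:R ^+ 2.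

Let q : algC := #|F|%:R.

Lemma q_gt0 : 0 < q ^+ 2.
Proof. by rewrite exprn_gt0 // ltr0n; apply/card_gt0P; exists 0. Qed.

Lemma correlation_trig x :
  q ^+ 2 * trig e correlation_coef setT x =
  (#|F| * #|A :&: translate B x|)%:R - (#|A| * #|B|)%:R.
Proof.
rewrite -set_fourier_correlation (bigD1 0) //= mul0r (char0 eD e_norm) mulr1.
rewrite !set_fourier0 conjC_nat -natrM [RHS]addrC addKr.
rewrite /trig (bigD1 0) ?inE //= {1}/correlation_coef eqxx mul0r add0r mulr_sumr.
apply: eq_big => [rho|rho /andP[_ rho0]]; first by rewrite inE.
rewrite /correlation_coef (negbTE rho0) -/q.
by rewrite mulrA mulrCA mulfV ?mulr1 // gt_eqF ?q_gt0.
Qed.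

(** The arithmetic-geometric mean inequality on each coefficient, followed by Parseval for [A] and
    [B]. *)
Lemma correlation_weight : weight correlation_coef setT <= 1.
Proof.
rewrite -(ler_pM2l q_gt0) mulr1 /weight mulr_sumr.
apply: (@le_trans _ _ (\sum_rho
   (`|set_fourier A rho| ^+ 2 + `|set_fourier B rho| ^+ 2) / 2%:R)).
  rewrite (eq_bigl predT) => [|rho]; last by rewrite inE.
  apply: ler_sum => rho _; rewrite /correlation_coef; case: eqP => _.
    by rewrite normr0 mulr0 mulr_ge0 ?invr_ge0 // addr_ge0 ?exprn_ge0.
  rewrite normrM normfV -/q (gtr0_norm q_gt0) mulrCA mulfV ?gt_eqF ?q_gt0 //.
  rewrite mulr1 normrM norm_conjC ler_pdivlMr ?ltr0n // mulr_natr.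
  by apply: (real_leif_mean_square_scaled _ _).1; rewrite normr_real.
rewrite -mulr_suml big_split /= !set_fourier_parseval -natrD -mulnDr.
rewrite ler_pdivrMr ?ltr0n // -natrX -natrM ler_nat -mulnA leq_mul2l.
by rewrite muln2 -addnn leq_add ?orbT ?max_card.
Qed.

Hypothesis F_cyclic :
  forall tau x y : F, tau != 0 -> exists k, y = x + tau *+ k.

Variable N : nat.
Hypothesis N_gt0 : (0 < N)%N.
Hypothesis F_large :
  (2 * ((4 * (2 * N ^ 3) ^ 2) ^ N.+1) ^ (N ^ 2) <= #|F|)%N.

Lemma correlation_small : exists x : F,
  N%:R * `|(#|F| * #|A :&: translate B x|)%:R - (#|A| * #|B|)%:R| <=
    4%:R * #|F|%:R ^+ 2 :> algC.
Proof.
have a0 : correlation_coef 0 = 0 by rewrite /correlation_coef eqxx.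
have trigE x : trig e correlation_coef setT x =
    ((#|F| * #|A :&: translate B x|)%:R - (#|A| * #|B|)%:R) / q ^+ 2.
  by rewrite -correlation_trig mulrC mulKf // gt_eqF ?q_gt0.
have [|x] := real_trig_small eD e_norm e_sum correlation_weight
  N_gt0 F_cyclic a0 F_large.
  move=> x; rewrite trigE realM ?realV ?realX ?realn //.
  by rewrite realB ?realn.
rewrite trigE normrM normfV (gtr0_norm q_gt0) mulrA ler_pdivrMr ?q_gt0 // => h.
by exists x.
Qed.

End Counting.

(** Distances of naturals are themselves naturals, so an inequality between them moves from [algC]
    to any other numeric domain. *)
Lemma dist_natr (R : numDomainType) (m n : nat) :
  `|m%:R - n%:R : R| = ((m - n) + (n - m))%:R.
Proof.
case: (leqP m n) => [mn|/ltnW nm].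
  by rewrite distrC -natrB // normr_nat (eqP (mn : (m - n == 0)%N)).
by rewrite -natrB // normr_nat (eqP (nm : (n - m == 0)%N)) addn0.
Qed.

(** * Additive characters of prime fields *)

Section PrimeField.

Variables (p : nat) (z : algC).
Hypothesis p_pr : prime p.
Hypothesis z_prim : p.-primitive_root z.

Definition Fp_char (x : 'F_p) := z ^+ x.

Lemma Fp_charD x y : Fp_char (x + y) = Fp_char x * Fp_char y.
Proof.
by rewrite /Fp_char -exprD /= [X in (_ %% X)%N]Fp_cast // prim_expr_mod.
Qed.

Lemma Fp_char_norm x : `|Fp_char x| = 1.
Proof.
rewrite normrX; suff -> : `|z| = 1 by rewrite expr1n.
apply/eqP; rewrite -(pexpr_eq1 (n := p)) ?prime_gt0 //.
by rewrite -normrX (prim_expr_order z_prim) normr1.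
Qed.

Lemma Fp_char_eq1 x : (Fp_char x == 1) = (x == 0).
Proof.
rewrite -(prim_order_dvd z_prim) -val_eqE /=.
have := ltn_ord x; rewrite [X in (_ < X)%N]Fp_cast //.
case: (val x) => [|k] kp; first by rewrite dvdn0.
by rewrite gtnNdvd.
Qed.

Lemma Fp_char_sum (rho : 'F_p) :
  \sum_t Fp_char (rho * t) = if rho == 0 then #|'F_p|%:R else 0.
Proof.
case: eqP => [->|/eqP rho0].
  by under eq_bigr do rewrite mul0r /Fp_char expr0; rewrite sumr_const.
set S := \sum_t _; have : Fp_char rho * S = S.
  rewrite mulr_sumr [RHS](reindex_inj (addrI 1)) /=.
  by apply: eq_bigr => t _; rewrite mulrDr mulr1 Fp_charD.
move/eqP; rewrite -subr_eq0 -{2}[S]mul1r -mulrBl mulf_eq0 subr_eq0.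
by rewrite Fp_char_eq1 (negbTE rho0) /= => /eqP.
Qed.

Lemma Fp_cyclic (tau x y : 'F_p) : tau != 0 -> exists k, y = x + tau *+ k.
Proof.
move=> tau0; exists (val ((y - x) / tau)).
rewrite -mulr_natr natr_Zp mulrC divfK //; ring.
Qed.

End PrimeField.

Lemma Fp_correlation_small p (A B : {set 'F_p}) N : prime p -> (0 < N)%N ->
  (2 * ((4 * (2 * N ^ 3) ^ 2) ^ N.+1) ^ (N ^ 2) <= p)%N ->
  exists x : 'F_p, forall R : numDomainType,
    N%:R * `|(p * #|A :&: translate B x|)%:R - (#|A| * #|B|)%:R : R| <=
    4%:R * p%:R ^+ 2.
Proof.
move=> p_pr N0 large; have [z z_prim] := C_prim_root_exists (prime_gt0 p_pr).
rewrite -{1}(card_Fp p_pr) in large.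
have [x] := correlation_small (Fp_charD p_pr z_prim)
  (Fp_char_norm p_pr z_prim) (Fp_char_sum p_pr z_prim) A B
  (@Fp_cyclic p) N0 large.
rewrite card_Fp // => h; exists x => R; move: h.
by rewrite !dist_natr -!natrX -!natrM !ler_nat.
Qed.

(** * Choice of the parameter *)

Lemma ln3_gt1 (R : realType) : 1 < ln (3%:R : R).
Proof.
(* [(6/5)^6 < 3] and [ln (5/6) <= -1/6]. *)
have h : ln (1 + (- 6%:R^-1) : R) <= - 6%:R^-1 by apply: le_ln1Dx; lra.
have E : 1 + (- 6%:R^-1) = (6%:R / 5%:R)^-1 :> R by field.
have p65 : (0 : R) < 6%:R / 5%:R by lra.
rewrite E lnV ?posrE // in h.
apply: (@le_lt_trans _ _ (ln ((6%:R / 5%:R) ^+ 6 : R))).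
  by rewrite lnXn // -[X in _ <= X]mulr_natr; lra.
by rewrite ltr_ln ?posrE ?exprn_gt0 //; lra.
Qed.

(** The left side is [2 (16 N^6)^((N+1) N^2)]. The hypothesis gives [N^3 <= ln p], hence
    [6 ln N <= 2 ln (ln p)]; with [N + 1 <= 2 N] its logarithm is at most
    [1 + (15 + 2 ln (ln p)) 2 N^3]. *)
Lemma search_bound_le (R : realType) (N p : nat) :
  (0 < N)%N -> (0 < p)%N -> 1 <= ln (p%:R : R) ->
  N%:R ^+ 3 * (31%:R + 4%:R * ln (ln (p%:R : R))) <= ln (p%:R : R) ->
  (2 * ((4 * (2 * N ^ 3) ^ 2) ^ N.+1) ^ (N ^ 2) <= p)%N.
Proof.
move=> N0 p0; set L := ln _; set l := ln L => L1 h.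
have l0 : 0 <= l by apply: ln_ge0.
have n1 : (1 : R) <= N%:R by rewrite ler1n.
have n3 : (1 : R) <= N%:R ^+ 3 by rewrite exprn_ege1.
have n3L : N%:R ^+ 3 <= L by apply: le_trans h; nra.
have lnn : 3%:R * ln (N%:R : R) <= l.
  by rewrite mulr_natl -lnXn ?ltr0n // ler_ln ?posrE ?exprn_gt0 ?ltr0n //; lra.
rewrite -(ler_nat R) -ler_ln ?posrE ?ltr0n //; last first.
  by rewrite !(muln_gt0, expn_gt0) N0.
apply: le_trans h.
have -> : (2 * ((4 * (2 * N ^ 3) ^ 2) ^ N.+1) ^ (N ^ 2))%:R =
    2%:R * (16%:R * N%:R ^+ 6) ^+ (N.+1 * N ^ 2) :> R.
  rewrite natrM natrX natrX natrM natrX natrM natrX -exprM; congr (_ * _ ^+ _).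
  ring.
have n0 : (0 : R) < N%:R by rewrite ltr0n.
have b0 : (0 : R) < 16%:R * N%:R ^+ 6 by rewrite mulr_gt0 ?exprn_gt0.
rewrite lnM ?posrE ?exprn_gt0 // lnXn // lnM ?posrE ?exprn_gt0 // lnXn //.
have l2 : ln (2%:R : R) <= 1.
  rewrite (_ : 2%:R = 1 + 1); last by ring.
  by apply: le_ln1Dx; lra.
have l16 : ln (16%:R : R) <= 15%:R.
  rewrite (_ : 16%:R = 1 + 15%:R); last by ring.
  by apply: le_ln1Dx; lra.
rewrite -(mulr_natr (_ + _)) -(mulr_natr (ln _)) natrM natrX -(natr1 N).
have lnN : 0 <= ln (N%:R : R) by apply: ln_ge0.
apply: (@le_trans _ _ (1 + (15%:R + 2%:R * l) * (2%:R * N%:R ^+ 3))); last by nra.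
apply: lerD => //.
apply: (@le_trans _ _ ((15%:R + 2%:R * l) * ((N%:R + 1) * N%:R ^+ 2))).
  apply: ler_wpM2r; last lra.
  by rewrite mulr_ge0 ?exprn_ge0 ?addr_ge0.
rewrite ler_wpM2l ?addr_ge0 ?mulr_ge0 //.
have : (0 : R) <= N%:R ^+ 2 by rewrite exprn_ge0.
by nra.
Qed.

Theorem theorem1p4 (R : realType) :
  exists2 C : R, 0 < C &
    forall (p : nat) (A B : {set 'F_p}) (alpha beta : R),
      prime p -> (3 <= p)%N ->
      #|A|%:R = alpha * p%:R -> #|B|%:R = beta * p%:R ->
      exists x : 'F_p,
        `| #|A :&: translate B x|%:R - alpha * beta * p%:R |
          <= C * p%:R * (ln (ln (p%:R : R)) / ln (p%:R : R)) `^ (1 / 3).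
Proof.
set l0 : R := ln (ln 3%:R).
have l0_gt0 : 0 < l0 by apply/ln_gt0/ln3_gt1.
(* Since [l0] is a positive lower bound for [l = ln (ln p)] when [p >= 3], this [c] gives
   [31 + 4 l <= c l]. *)
pose c : R := 31%:R / l0 + 4%:R.
have c0 : 0 < c by rewrite addr_gt0 ?divr_gt0.
exists (8%:R * c `^ (1 / 3)); first by rewrite mulr_gt0 ?powR_gt0.
move=> p A B alpha beta p_pr p3 hA hB.
set L := ln (p%:R : R); set l := ln L.
have p0 : (0 < p)%N by apply: leq_trans p3.
have pR : (0 : R) < p%:R by rewrite ltr0n.
have L3 : ln 3%:R <= L by rewrite ler_ln ?posrE ?ltr0n ?ler_nat.
have L1 : 1 < L by apply: lt_le_trans (ln3_gt1 R) L3.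
have ll0 : l0 <= l.
  by rewrite ler_ln ?posrE ?(lt_trans ltr01 L1) // (lt_trans ltr01 (ln3_gt1 R)).
have l_gt0 : 0 < l by apply: lt_le_trans ll0.
have r_gt0 : 0 < l / L by rewrite divr_gt0 // (lt_trans ltr01).
set w := (c * (l / L)) `^ (1 / 3).
have wE : 8%:R * c `^ (1 / 3) * p%:R * (l / L) `^ (1 / 3) = 8%:R * w * p%:R.
  by rewrite /w (powRM _ (ltW c0) (ltW r_gt0)); ring.
have cr0 : 0 < c * (l / L) by rewrite mulr_gt0.
have w0 : 0 < w by apply: powR_gt0.
have w3 : w ^+ 3 = c * (l / L).
  by rewrite -powR_mulrn ?ltW // -powRrM mul1r mulVf ?pnatr_eq0 // powRr1 ?ltW.
rewrite wE; set N := Num.truncn w^-1.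
have [Nle Nlt] : N%:R <= w^-1 /\ w^-1 < N%:R + 1.
  by apply/andP; rewrite natr1 truncn_itv // invr_ge0 ltW.
have wN : 1 < w * (N%:R + 1) by rewrite -ltr_pdivrMl // mulr1.
(* [N = 0] means [w > 1]; the claimed bound then exceeds [8 p] and holds trivially, at [x = 0] for
   instance. *)
have [N0|N0] := posnP N.
  exists 0; rewrite N0 add0r mulr1 in wN.
  have n_le : #|A :&: translate B 0|%:R <= p%:R :> R.
    by rewrite ler_nat -[X in (_ <= X)%N](card_Fp p_pr) max_card.
  have a_le : alpha * p%:R <= p%:R.
    by rewrite -hA ler_nat -[X in (_ <= X)%N](card_Fp p_pr) max_card.
  have b_le : beta * p%:R <= p%:R.
    by rewrite -hB ler_nat -[X in (_ <= X)%N](card_Fp p_pr) max_card.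
  have a_ge : 0 <= alpha * p%:R by rewrite -hA.
  have b_ge : 0 <= beta * p%:R by rewrite -hB.
  have n_ge : (0 : R) <= #|A :&: translate B 0|%:R by [].
  have al0 : 0 <= alpha by rewrite pmulr_lge0 // in a_ge.
  have al1 : alpha <= 1 by rewrite -(ger_pMl _ pR).
  rewrite ler_norml -mulrA; apply/andP; split; nra.
have [|x /(_ R) hx] := Fp_correlation_small (N := N) A B p_pr N0.
  apply: (@search_bound_le R) => //; first exact: ltW.
  rewrite -/L -/l; apply: (@le_trans _ _ (N%:R ^+ 3 * (c * l))).
    apply: ler_wpM2l; first exact: exprn_ge0.
    rewrite /c [X in _ <= X]mulrDl lerD2r mulrAC ler_pdivlMr //.
    by rewrite ler_wpM2l.
  (* The size condition becomes [(N w)^3 <= 1], true because [N] is the integer part of [1 / w]. *)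
  have -> : c * l = w ^+ 3 * L.
    by rewrite w3 mulrA mulfVK // gt_eqF // (lt_trans ltr01).
  rewrite mulrA -exprMn -[X in _ <= X]mul1r; apply: ler_wpM2r; first by lra.
  apply: exprn_ile1; first by rewrite mulr_ge0 // ltW.
  by rewrite -ler_pdivlMr // mul1r.
exists x; move: hx; rewrite !natrM hA hB.
have -> : p%:R * #|A :&: translate B x|%:R - alpha * p%:R * (beta * p%:R) =
  p%:R * (#|A :&: translate B x|%:R - alpha * beta * p%:R) by ring.
rewrite normrM (gtr0_norm pR); set d := `| _ |.
have d0 : 0 <= d by apply: normr_ge0.
have n1 : (1 : R) <= N%:R by rewrite ler1n.
rewrite expr2 mulrCA [X in _ <= X]mulrCA ler_pM2l // => hx.
(* From [w (N + 1) > 1] and [N + 1 <= 2 N]; this is the origin of the constant 8. *)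
have h8 : 4%:R <= 8%:R * w * N%:R by nra.
rewrite -(ler_pM2l (_ : 0 < N%:R)) ?ltr0n //; nra.
Qed.
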